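(* Let $A\in\mathbb{R}^{n\times n}$ be diagonalizable over $\mathbb{C}$ ($A$ may be singular), $\boldsymbol{b}\in\mathcal{R}(A)$, $\boldsymbol{x}_0\in\mathbb{R}^n$, $\boldsymbol{r}_0=\boldsymbol{b}-A\boldsymbol{x}_0$, and let $d$ be the grade of the Krylov subspaces $\mathcal{K}_k(A,\boldsymbol{r}_0)$. Let $\boldsymbol{r}_0=c_1\boldsymbol{v}_1+\dots+c_d\boldsymbol{v}_d$, where $\boldsymbol{v}_i\in\mathbb{C}^n$, $\|\boldsymbol{v}_i\|_2=1$, are eigenvectors of $A$ corresponding to pairwise distinct nonzero eigenvalues $\lambda_i\in\mathbb{C}$ ($i=1,\dots,d$), and $c_i\in\mathbb{C}$. Let $k\geq 1$ and let $\gamma_1,\dots,\gamma_k\in\mathbb{C}$ be distinct nonzero cluster centers, so that each $\lambda_i$ is of the form $\lambda_i=\gamma_{j}+\epsilon_i$ for some $j=j(i)\in\{1,\dots,k\}$ with $0\leq|\epsilon_i|\leq\epsilon$, where $\epsilon=\max(|\epsilon_1|,\dots,|\epsilon_d|)$ is small. Define $$f(\gamma)=(-1)^{k-1}\frac{1}{\prod_{j=1}^k\gamma_j}\prod_{j=1}^k(\gamma-\gamma_j).$$ Then $$\min_{\boldsymbol{x}_k=\boldsymbol{x}_0+\boldsymbol{z}_k,\ \boldsymbol{z}_k\in\mathcal{K}_k(A,\boldsymbol{r}_0)}\|\boldsymbol{b}-A\boldsymbol{x}_k\|_2\;\leq\;\|V_d\,\mathrm{diag}[c_1,c_2,\dots,c_d]\|_2\;\|(f(\lambda_1),f(\lambda_2),\dots,f(\lambda_d))^\top\|_2,$$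 where $V_d=[\boldsymbol{v}_1,\dots,\boldsymbol{v}_d]\in\mathbb{C}^{n\times d}$.
   Context: $\mathcal{R}(A)$ is the range of $A$. The Krylov subspace is $\mathcal{K}_k(A,\boldsymbol{r}_0)=\mathrm{span}\{\boldsymbol{r}_0,A\boldsymbol{r}_0,\dots,A^{k-1}\boldsymbol{r}_0\}$. The grade $d$ is the smallest integer such that $\mathcal{K}_d(A,\boldsymbol{r}_0)=\mathcal{K}_{d+1}(A,\boldsymbol{r}_0)$. The matrix norm $\|\cdot\|_2$ is the spectral (operator) norm. The word ''small'' ($\epsilon\ll 1$) carries no quantitative threshold: the inequality is an exact inequality. The number of cluster centers used equals the iteration number $k$. *)

(* Defs.v *)
From HB Require Import structures.
From mathcomp Require Import all_boot all_order all_algebra.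
From mathcomp Require Import complex.
From mathcomp Require Import all_classical all_reals.

Set Implicit Arguments.
Unset Strict Implicit.
Unset Printing Implicit Defensive.

Import Order.TTheory GRing.Theory Num.Theory.

Local Open Scope ring_scope.
Local Open Scope classical_set_scope.
Local Open Scope complex_scope.

(* The norm of R[i] takes its values in R[i]; this is the modulus in R. *)
Definition modulus (R : realType) (z : R[i]) : R := ComplexField.Normc.normc z.

Definition norm2 (R : realType) (n : nat) (x : 'cV[R]_n) : R :=
  Num.sqrt (\sum_(i < n) x i 0 ^+ 2).

Definition cnorm2 (R : realType) (n : nat) (x : 'cV[R[i]]_n) : R :=
  Num.sqrt (\sum_(i < n) modulus (x i 0) ^+ 2).

(* The supremum is over the closed unit ball rather than the unit sphere, so
   that it ranges over a nonempty set also for matrices without columns. *)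
Definition spectral_norm (R : realType) (m n : nat) (M : 'M[R[i]]_(m, n)) : R :=
  sup [set cnorm2 (M *m x) | x in [set x : 'cV[R[i]]_n | cnorm2 x <= 1]].

Definition complexify (R : realType) (m n : nat) (M : 'M[R]_(m, n)) :
  'M[R[i]]_(m, n) := map_mx (real_complex R) M.

Definition krylov (R : realType) (n : nat) (A : 'M[R]_n) (r : 'cV[R]_n)
  (k : nat) : {vspace 'cV[R]_n} :=
  <<[seq (A ^+ i) *m r | i <- iota 0 k]>>%VS.

(* The zeroth Krylov space is 0, so the grade is 0 exactly when r = 0. *)
Definition is_grade (R : realType) (n : nat) (A : 'M[R]_n) (r : 'cV[R]_n)
  (d : nat) : Prop :=
  krylov A r d = krylov A r d.+1 /\
  forall m : nat, krylov A r m = krylov A r m.+1 -> (d <= m)%N.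

Definition is_minimum (R : realType) (S : set R) (m : R) : Prop :=
  S m /\ lbound S m.

Definition cluster_fun (R : realType) (k : nat) (g : 'I_k -> R[i])
  (x : R[i]) : R[i] :=
  (-1) ^+ k.-1 * (1 / \prod_(j < k) g j) * \prod_(j < k) (x - g j).

(* Main.v *)
(* The polynomial P = - f has degree k and P(0) = 1. As A and r0 are real,
   replacing the coefficients of P by their real parts gives a real polynomial
   p = 1 - X q with p(A) r0 = Re (P(A) r0), so x0 + q(A) r0 is feasible and its
   residual p(A) r0 is no longer than P(A) r0 = V_d diag(c) (P(lam_i))_i. The
   minimum is attained because it is a least squares problem, whose normal
   equations are solvable: M^T M and M have the same row space. *)
Require Import Defs.
From HB Require Import structures.
From mathcomp Require Import all_boot all_order all_algebra.
From mathcomp Require Import complex zify ring.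
From mathcomp Require Import all_classical all_reals.

Set Implicit Arguments.
Unset Strict Implicit.
Unset Printing Implicit Defensive.

Import Order.TTheory GRing.Theory Num.Theory.

Local Open Scope ring_scope.
Local Open Scope classical_set_scope.
Local Open Scope complex_scope.

(** * Real least squares *)

Lemma normal_equation_solvable (R : realFieldType) (m n : nat)
  (M : 'M[R]_(m, n)) (r : 'cV[R]_m) :
  exists y : 'cV[R]_n, M^T *m (r - M *m y) = 0.
Proof.
(* The diagonal of [u *m u^T] holds the sums of squares of the rows of [u]. *)
have gram0 (p q : nat) (u : 'M[R]_(p, q)) : u *m u^T = 0 -> u = 0.
  move=> /matrixP u0; apply/matrixP => i l; rewrite mxE.
  move: (u0 i i); rewrite !mxE => /eqP.
  rewrite psumr_eq0; last by move=> t _; rewrite mxE -expr2 sqr_ge0.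
  by move=> /allP/(_ l (mem_index_enum _)); rewrite mxE -expr2 sqrf_eq0 => /eqP.
(* With [K := kermx (M^T *m M)], the product of [K *m M^T] with its own transpose is
   [K *m M^T *m M *m K^T = 0]. *)
have ker_sub : (kermx (M^T *m M) <= kermx M^T)%MS.
  apply/sub_kermxP/gram0.
  by rewrite trmx_mul trmxK mulmxA -[_ *m M]mulmxA mulmx_ker mul0mx.
(* Comparing kernel dimensions reverses the inequality between ranks; the two rank bounds by [n]
   keep the truncated subtractions exact. *)
have rank_le : (\rank M <= \rank (M^T *m M))%N.
  have := mxrankS ker_sub; rewrite !mxrank_ker mxrank_tr.
  by have := rank_leq_row (M^T *m M); have := rank_leq_col M; lia.
have M_sub : (M <= M^T *m M)%MS.
  rewrite -(mxrank_leqif_sup (submxMl M^T M)).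
  by rewrite eqn_leq rank_le mxrankS// submxMl.
(* This is the transposed normal equation [r^T *m M = y *m (M^T *m M)]. *)
have /submxP[y rM] : (r^T *m M <= M^T *m M)%MS.
  exact: submx_trans (submxMl _ _) M_sub.
exists y^T; apply: (can_inj (@trmxK _ _ _)).
by rewrite trmx_mul raddfB /= !trmx_mul !trmxK mulmxBl rM trmx0 mulmxA subrr.
Qed.

Lemma norm2_least_squares (R : realType) (m n : nat) (M : 'M[R]_(m, n))
  (r : 'cV[R]_m) :
  exists y : 'cV[R]_n, forall z, norm2 (r - M *m y) <= norm2 (r - M *m z).
Proof.
have [y Hy] := normal_equation_solvable M r; exists y => z.
rewrite /norm2 ler_wsqrtr//.
set u := r - M *m y in Hy *; pose w := M *m (y - z).
have -> : r - M *m z = u + w by rewrite /u /w mulmxBr addrA subrK.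
(* The residual [u] is orthogonal to the column space of [M], which contains [w], so Pythagoras
   applies. *)
have uw : \sum_i u i 0 * w i 0 = 0.
  have E : (w^T *m u) 0 0 = 0 by rewrite /w trmx_mul -mulmxA Hy mulmx0 mxE.
  by rewrite -[RHS]E mxE; apply: eq_bigr => i _; rewrite !mxE mulrC.
have -> : \sum_i (u + w) i 0 ^+ 2 =
    \sum_i u i 0 ^+ 2 + 2 * (\sum_i u i 0 * w i 0) + \sum_i w i 0 ^+ 2.
  by rewrite mulr_sumr -!big_split; apply: eq_bigr => i _ /=; rewrite mxE; ring.
by rewrite uw mulr0 addr0 lerDl sumr_ge0// => i _; exact: sqr_ge0.
Qed.

(** Least squares for the matrix whose columns form a basis of [U]: its products with vectors are
    exactly the elements of [U]. *)
Lemma norm2_vspace_closest (R : realType) (m : nat) (U : {vspace 'cV[R]_m})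
  (r : 'cV[R]_m) :
  exists2 w, w \in U & forall w', w' \in U -> norm2 (r - w) <= norm2 (r - w').
Proof.
pose M : 'M[R]_(m, \dim U) := \matrix_(i, l) (vbasis U)`_l i 0.
have ME (y : 'cV[R]_(\dim U)) : M *m y = \sum_l y l 0 *: (vbasis U)`_l.
  apply/colP => i; rewrite mxE summxE.
  by apply: eq_bigr => l _; rewrite !mxE mulrC.
have [y y_min] := norm2_least_squares M r.
exists (M *m y).
  rewrite ME; apply: memv_suml => l _; apply/memvZ/vbasis_mem/mem_nth.
  by rewrite size_tuple.
move=> w' /coord_vbasis w'E.
have -> : w' = M *m \col_l coord (vbasis U) l w'.
  by rewrite ME [LHS]w'E; apply: eq_bigr => l _; rewrite mxE.
exact: y_min.
Qed.

(** * Modulus, Euclidean norm and spectral norm over the complex numbers *)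

Lemma modulus_ge0 (R : realType) (z : R[i]) : 0 <= modulus z.
Proof. by case: z => a b; exact: sqrtr_ge0. Qed.

Lemma sqr_modulus (R : realType) (z : R[i]) :
  modulus z ^+ 2 = complex.Re z ^+ 2 + complex.Im z ^+ 2.
Proof.
by case: z => a b; rewrite /modulus /= sqr_sqrtr// addr_ge0// sqr_ge0.
Qed.

Lemma modulus0 (R : realType) : modulus (0 : R[i]) = 0.
Proof. exact: ComplexField.Normc.normc0. Qed.

Lemma modulusM (R : realType) (x y : R[i]) :
  modulus (x * y) = modulus x * modulus y.
Proof. exact: ComplexField.Normc.normcM. Qed.

Lemma modulus_sum (R : realType) (I : finType) (F : I -> R[i]) :
  modulus (\sum_i F i) <= \sum_i modulus (F i).
Proof.
elim/big_ind2: _ => [|x a y b xa yb|//]; first by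
  rewrite modulus0.
exact: le_trans (le_normcD _ _) (lerD xa yb).
Qed.

Lemma cnorm2_ge0 (R : realType) (n : nat) (x : 'cV[R[i]]_n) : 0 <= cnorm2 x.
Proof. exact: sqrtr_ge0. Qed.

Lemma cnorm2Z (R : realType) (n : nat) (a : R[i]) (x : 'cV[R[i]]_n) :
  cnorm2 (a *: x) = modulus a * cnorm2 x.
Proof.
rewrite -[modulus a]ger0_norm ?modulus_ge0// -sqrtr_sqr -sqrtrM ?sqr_ge0//.
rewrite mulr_sumr; congr Num.sqrt; apply: eq_bigr => i _.
by rewrite mxE modulusM exprMn.
Qed.

Lemma modulus_le_cnorm2 (R : realType) (n : nat) (x : 'cV[R[i]]_n) i :
  modulus (x i 0) <= cnorm2 x.
Proof.
rewrite -[modulus _]ger0_norm ?modulus_ge0// -sqrtr_sqr ler_wsqrtr//.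
by rewrite (bigD1 i)//= lerDl sumr_ge0// => l _; exact: sqr_ge0.
Qed.

Lemma cnorm2_eq0 (R : realType) (n : nat) (x : 'cV[R[i]]_n) :
  cnorm2 x = 0 -> x = 0.
Proof.
move=> x0; apply/colP => i; rewrite mxE; apply: ComplexField.Normc.eq0_normc.
by apply/eqP; rewrite eq_le modulus_ge0 andbT -x0 modulus_le_cnorm2.
Qed.

Lemma norm2_Re_le (R : realType) (n : nat) (x : 'cV[R[i]]_n) :
  norm2 (map_mx (@complex.Re R) x) <= cnorm2 x.
Proof.
rewrite ler_wsqrtr// ler_sum// => i _.
by rewrite mxE sqr_modulus lerDl sqr_ge0.
Qed.

(** Without boundedness [sup] would be a default value, and [spectral_norm] would bound nothing. *)
Lemma has_sup_spectral_norm (R : realType) (m n : nat) (M : 'M[R[i]]_(m, n)) :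
  has_sup [set cnorm2 (M *m x) | x in [set x : 'cV[R[i]]_n | cnorm2 x <= 1]].
Proof.
split.
  exists (cnorm2 (M *m 0)); exists 0 => //=.
  rewrite /cnorm2 big1 ?sqrtr0// => i _.
  by rewrite mxE modulus0 expr0n.
(* Entries of a vector in the unit ball have modulus at most 1, so each entry of [M *m x] is bounded
   by the sum of the moduli in its row of [M]. *)
exists (Num.sqrt (\sum_i (\sum_l modulus (M i l)) ^+ 2)) => _ [x /= x1 <-].
rewrite ler_wsqrtr// ler_sum// => i _.
rewrite lerXn2r ?nnegrE ?modulus_ge0 ?sumr_ge0// => [l _|].
  exact: modulus_ge0.
rewrite mxE; apply: le_trans (modulus_sum _) _; apply: ler_sum => l _.
rewrite modulusM ler_piMr ?modulus_ge0//.
exact: le_trans (modulus_le_cnorm2 x l) x1.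
Qed.

Lemma cnorm2_mulmx_le (R : realType) (m n : nat) (M : 'M[R[i]]_(m, n))
  (x : 'cV[R[i]]_n) : cnorm2 (M *m x) <= spectral_norm M * cnorm2 x.
Proof.
have [x0|x_neq0] := eqVneq (cnorm2 x) 0.
  rewrite x0 mulr0 (cnorm2_eq0 x0) mulmx0.
  by rewrite -[X in cnorm2 X](scale0r 0) cnorm2Z modulus0 mul0r.
have x_gt0 : 0 < cnorm2 x by rewrite lt_neqAle eq_sym x_neq0 cnorm2_ge0.
pose a : R[i] := (cnorm2 x)^-1%:C.
have aE : modulus a = (cnorm2 x)^-1.
  by rewrite /modulus /= expr0n addr0 sqrtr_sqr ger0_norm// invr_ge0 ltW.
rewrite -ler_pdivrMr// mulrC -aE -cnorm2Z scalemxAr.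
apply: ub_le_sup; first by have [] := has_sup_spectral_norm M.
by exists (a *: x) => //=; rewrite cnorm2Z aE mulVf.
Qed.

(** * Real parts of polynomials in [A] applied to [r] *)

Lemma Re_sum (R : realType) (I : finType) (F : I -> R[i]) :
  complex.Re (\sum_i F i) = \sum_i complex.Re (F i).
Proof. by apply: (big_morph (@complex.Re R)) => // -[a b] []. Qed.

Lemma Re_mulr_real (R : realType) (z : R[i]) (a : R) :
  complex.Re (z * a%:C) = complex.Re z * a.
Proof. by case: z => x y /=; rewrite mulr0 subr0. Qed.

Lemma complexify_pow_eigen (R : realType) (n d : nat) (A : 'M[R]_n)
  (r : 'cV[R]_n) (c lam : 'I_d -> R[i]) (v : 'I_d -> 'cV[R[i]]_n)
  (rE : complexify r = \sum_(l < d) c l *: v l)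
  (v_eigenvector : forall l : 'I_d, complexify A *m v l = lam l *: v l)
  (s : nat) :
  complexify (A ^+ s *m r) = \sum_(l < d) (c l * lam l ^+ s) *: v l.
Proof.
elim: s => [|s IHs].
  by rewrite expr0 mul1mx rE; apply: eq_bigr => l _; rewrite mulr1.
rewrite exprS -mulmxA [complexify _]map_mxM [map_mx _ (_ *m r)]IHs mulmx_sumr.
apply: eq_bigr => l _; rewrite -scalemxAr v_eigenvector scalerA exprSr.
by rewrite mulrA.
Qed.

(* Keeping only the real parts of the coefficients of [P] turns [P(A) r] into
   its real part, since [A] and [r] are real. *)
Lemma norm2_Re_poly_le (R : realType) (n d k : nat) (A : 'M[R]_n)
  (r : 'cV[R]_n) (c lam : 'I_d -> R[i]) (v : 'I_d -> 'cV[R[i]]_n)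
  (P : {poly R[i]})
  (rE : complexify r = \sum_(l < d) c l *: v l)
  (v_eigenvector : forall l : 'I_d, complexify A *m v l = lam l *: v l) :
  (size P <= k)%N ->
  norm2 (\sum_(s < k) complex.Re P`_s *: (A ^+ s *m r)) <=
    spectral_norm
      ((\matrix_(i < n, l < d) v l i 0) *m diag_mx (\row_(l < d) c l))
    * cnorm2 (\col_(l < d) P.[lam l]).
Proof.
move=> sizeP; apply: le_trans (cnorm2_mulmx_le _ _).
have -> : \sum_(s < k) complex.Re P`_s *: (A ^+ s *m r) =
    map_mx (@complex.Re R) (\sum_(s < k) P`_s *: complexify (A ^+ s *m r)).
  apply/colP => i; rewrite mxE !summxE Re_sum; apply: eq_bigr => s _.
  by rewrite [in RHS]mxE [complexify _ _ _]mxE Re_mulr_real mxE.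
(* Both sides are [P(A) r]: expanded over the eigenvectors on the left, over the powers of [A] on
   the right. *)
have -> : (\matrix_(i < n, l < d) v l i 0) *m diag_mx (\row_(l < d) c l)
      *m (\col_(l < d) P.[lam l]) =
    \sum_(s < k) P`_s *: complexify (A ^+ s *m r).
  under eq_bigr do rewrite (complexify_pow_eigen rE v_eigenvector) scaler_sumr.
  rewrite exchange_big /=; apply/colP => i; rewrite mul_mx_diag mxE summxE.
  apply: eq_bigr => l _; rewrite !mxE (horner_coef_wide _ sizeP) mulr_sumr.
  by rewrite summxE; apply: eq_bigr => s _; rewrite !mxE; ring.
exact: norm2_Re_le.
Qed.

Lemma cluster_poly (R : realType) (k : nat) (g : 'I_k -> R[i])
  (g_neq0 : forall l : 'I_k, g l != 0) (k_ge1 : (1 <= k)%N) :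
  exists P : {poly R[i]}, [/\ (size P <= k.+1)%N, P`_0 = 1 &
    forall x, P.[x] = - cluster_fun g x].
Proof.
exists (- ((-1) ^+ k.-1 * (1 / \prod_(j < k) g j))
         *: \prod_(j < k) ('X - (g j)%:P)).
have E x : (- ((-1) ^+ k.-1 * (1 / \prod_(j < k) g j))
         *: \prod_(j < k) ('X - (g j)%:P)).[x] = - cluster_fun g x.
  rewrite hornerZ horner_prod mulNr; congr (- (_ * _)).
  by apply: eq_bigr => l _; rewrite hornerXsubC.
split=> //.
  apply: leq_trans (size_scale_leq _ _) _.
  by rewrite size_prod_XsubC /index_enum unlock -enumT size_enum_ord.
rewrite -horner_coef0 E /cluster_fun.
have -> : \prod_(j < k) (0 - g j) = (-1) ^+ k * \prod_(j < k) g j.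
  under eq_bigr do rewrite sub0r -mulN1r.
  by rewrite big_split /= prodr_const card_ord.
have prod_neq0 : \prod_(j < k) g j != 0 by apply/prodf_neq0 => l _.
(* Writing [k] as a successor makes [k.-1] exact. The signs [(-1)^(k-1)] and [(-1)^k] then multiply
   to -1, which cancels the leading minus of [P]. *)
case: k g g_neq0 k_ge1 E prod_neq0 => // k g _ _ _ prod_neq0.
rewrite /= exprS div1r mulrACA -mulrA mulVf// mulr1 mulN1r mulrN -exprD.
by rewrite opprK addnn -signr_odd odd_double.
Qed.

Theorem theorem2 (R : realType) (n : nat) (A : 'M[R]_n) (b x0 : 'cV[R]_n)
  (d k : nat) (c lam e : 'I_d -> R[i]) (v : 'I_d -> 'cV[R[i]]_n)
  (g : 'I_k -> R[i]) (j : 'I_d -> 'I_k) (eps : R)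
  (A_diagonalizable : diagonalizable (complexify A))
  (b_range : range (fun x : 'cV[R]_n => A *m x) b)
  (d_grade : is_grade A (b - A *m x0) d)
  (r0_decomposition :
     complexify (b - A *m x0) = \sum_(i < d) c i *: v i)
  (v_unit : forall i : 'I_d, cnorm2 (v i) = 1)
  (v_eigenvector : forall i : 'I_d, complexify A *m v i = lam i *: v i)
  (lam_distinct : injective lam)
  (lam_neq0 : forall i : 'I_d, lam i != 0)
  (k_ge1 : (1 <= k)%N)
  (g_distinct : injective g)
  (g_neq0 : forall l : 'I_k, g l != 0)
  (lam_cluster : forall i : 'I_d, lam i = g (j i) + e i)
  (e_le_eps : forall i : 'I_d, 0 <= modulus (e i) <= eps)
  (eps_max : eps = \big[Num.max/0]_(i < d) modulus (e i)) :
  exists2 m : R,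
    is_minimum
      [set norm2 (b - A *m xk) | xk in
         [set x0 + z | z in [set z | z \in krylov A (b - A *m x0) k]]] m
    & m <= spectral_norm
             ((\matrix_(i < n, l < d) v l i 0) *m diag_mx (\row_(l < d) c l))
           * cnorm2 (\col_(i < d) cluster_fun g (lam i)).
Proof.
set r := b - A *m x0.
(* The residual of [x0 + z] is [r - A *m z], so minimizing it over the Krylov space means finding
   the point closest to [r] in the image of that space under [A]. *)
have [w wAK w_min] := norm2_vspace_closest (linfun (mulmx A) @: krylov A r k) r.
have resE z : b - A *m (x0 + z) = r - A *m z by rewrite mulmxDr opprD addrA.
exists (norm2 (r - w)).
  split.
    have [z zK ->] := memv_imgP wAK.
    by exists (x0 + z); [exists z | rewrite resE lfunE].
  move=> _ [_ [z /= zK <-] <-]; rewrite resE; apply: w_min.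
  by rewrite -[A *m z](lfunE (mulmx A)) memv_img.
have [P [sizeP P0 PE]] := cluster_poly g_neq0 k_ge1.
(* The norm does not see the sign in [P = -f]. *)
have -> : cnorm2 (\col_i cluster_fun g (lam i)) = cnorm2 (\col_i P.[lam i]).
  congr Num.sqrt; apply: eq_bigr => i _.
  by rewrite !mxE PE !sqr_modulus !raddfN !sqrrN.
apply: le_trans (norm2_Re_poly_le r0_decomposition v_eigenvector sizeP).
(* This is [z = q(A) r] for the real polynomial [p = 1 - X q], hence the index shift and the sign.
   As [P] has degree at most [k], only powers of [A] below [k] occur, so [z] lies in the Krylov
   space. *)
pose z := - \sum_(s < k) complex.Re P`_s.+1 *: (A ^+ s *m r).
have -> : \sum_(s < k.+1) complex.Re P`_s *: (A ^+ s *m r) = r - A *m z.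
  rewrite big_ord_recl /= P0 expr0 mul1mx scale1r mulmxN opprK mulmx_sumr.
  congr (_ + _); apply: eq_bigr => s _.
  by rewrite -scalemxAr mulmxA /bump add1n exprS.
apply: w_min; rewrite -[A *m z](lfunE (mulmx A)) memv_img// memvN.
apply: memv_suml => s _; apply/memvZ/memv_span/mapP.
by exists (val s) => //; rewrite mem_iota ltn_ord.
Qed.
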